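(* Let $A$ be a commutative ring and $n\ge 2$ an integer. Then the involution $\Gamma:Q_{2n}(A)\to Q_{2n}(A)$ given by $$\Gamma(s;f_1,\ldots,f_n;g_1,\ldots,g_n)=(1-s;f_1,\ldots,f_n;g_1,\ldots,g_n)$$ induces a bijective map $\widetilde{\Gamma}:\pi_0(Q_{2n})(A)\to\pi_0(Q_{2n})(A)$ which is also an involution, meaning $\widetilde{\Gamma}^2=1_{\pi_0(Q_{2n})(A)}$.
   Context: $Q_{2n}(A)=\{(s;f_1,\ldots,f_n;g_1,\ldots,g_n)\in A^{2n+1}:\sum_{i=1}^n f_ig_i+s(s-1)=0\}$, and $\pi_0(Q_{2n})(A)$ is the quotient of $Q_{2n}(A)$ by the equivalence relation generated by $H(0)\sim H(1)$ for $H(T)\in Q_{2n}(A[T])$. *)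

(* Defs.v *)
From HB Require Import structures.
From Stdlib Require Import Relation_Operators.
From mathcomp Require Import all_boot all_algebra.
From mathcomp Require Import boolp.

Set Implicit Arguments.
Unset Strict Implicit.
Unset Printing Implicit Defensive.

Import GRing.Theory.
Local Open Scope ring_scope.
Local Open Scope quotient_scope.

(* Points of A^(2n+1) are triples (s, f, g) with f and g row vectors. *)
Definition quadric_eq (A : comNzRingType) (n : nat)
    (v : A * 'rV[A]_n * 'rV[A]_n) : bool :=
  let: (s, f, g) := v in \sum_(i < n) f 0 i * g 0 i + s * (s - 1) == 0.

Record Q2n (A : comNzRingType) (n : nat) := MkQ2n {
  Q2n_val : A * 'rV[A]_n * 'rV[A]_n;
  Q2n_valP : quadric_eq Q2n_val
}.

HB.instance Definition _ (A : comNzRingType) (n : nat) :=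
  [isSub for @Q2n_val A n].
HB.instance Definition _ (A : comNzRingType) (n : nat) :=
  [Choice of Q2n A n by <:].

Definition map_coords (A B : comNzRingType) (n : nat) (phi : A -> B)
    (v : A * 'rV[A]_n * 'rV[A]_n) : B * 'rV[B]_n * 'rV[B]_n :=
  let: (s, f, g) := v in (phi s, map_mx phi f, map_mx phi g).

Lemma map_coords_quadric (A B : comNzRingType) (n : nat)
    (phi : {rmorphism A -> B}) (v : Q2n A n) :
  quadric_eq (map_coords phi (Q2n_val v)).
Proof.
case: v => [[[s f] g]] /= /eqP e.
rewrite -(rmorph1 phi) -rmorphB -rmorphM; apply/eqP.
transitivity (phi (\sum_(i < n) f 0 i * g 0 i + s * (s - 1))).
  rewrite rmorphD rmorph_sum; congr (_ + _); apply: eq_bigr => i _.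
  by rewrite !mxE rmorphM.
by rewrite e rmorph0.
Qed.

Definition Q2n_map (A B : comNzRingType) (n : nat) (phi : {rmorphism A -> B})
    (v : Q2n A n) : Q2n B n :=
  MkQ2n (map_coords_quadric phi v).

(* H(a), for H(T) in Q_2n(A[T]) and a in A. *)
Definition Q2n_eval (A : comNzRingType) (n : nat) (H : Q2n {poly A} n)
    (a : A) : Q2n A n :=
  Q2n_map (horner_eval a) H.

Definition elem_homotopic (A : comNzRingType) (n : nat) (x y : Q2n A n) : Prop :=
  exists H : Q2n {poly A} n, Q2n_eval H 0 = x /\ Q2n_eval H 1 = y.

Definition homotopic (A : comNzRingType) (n : nat) : rel (Q2n A n) :=
  fun x y => `[< clos_refl_sym_trans (Q2n A n) (@elem_homotopic A n) x y >].

Lemma homotopic_refl (A : comNzRingType) (n : nat) :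
  reflexive (@homotopic A n).
Proof. by move=> x; apply/asboolP; apply: rst_refl. Qed.

Lemma homotopic_sym (A : comNzRingType) (n : nat) : symmetric (@homotopic A n).
Proof.
by move=> x y; apply/asboolP/asboolP => h; apply: rst_sym.
Qed.

Lemma homotopic_trans (A : comNzRingType) (n : nat) :
  transitive (@homotopic A n).
Proof.
move=> y x z /asboolP hxy /asboolP hyz; apply/asboolP.
exact: rst_trans hxy hyz.
Qed.

Canonical homotopic_equiv (A : comNzRingType) (n : nat) :=
  EquivRel (@homotopic A n) (@homotopic_refl A n) (@homotopic_sym A n)
    (@homotopic_trans A n).

Definition pi0_Q2n (A : comNzRingType) (n : nat) : Type :=
  {eq_quot (@homotopic A n)}.

Definition pi0_class (A : comNzRingType) (n : nat) (x : Q2n A n) :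
    pi0_Q2n A n :=
  \pi_({eq_quot (@homotopic A n)}) x.

Definition Gamma_coords (A : comNzRingType) (n : nat)
    (v : A * 'rV[A]_n * 'rV[A]_n) : A * 'rV[A]_n * 'rV[A]_n :=
  let: (s, f, g) := v in (1 - s, f, g).

Lemma Gamma_quadric (A : comNzRingType) (n : nat) (v : Q2n A n) :
  quadric_eq (Gamma_coords (Q2n_val v)).
Proof.
case: v => [[[s f] g]] /= e; rewrite [1 - s - 1]addrAC subrr add0r.
by rewrite mulrN -mulNr opprB mulrC.
Qed.

Definition Gamma (A : comNzRingType) (n : nat) (v : Q2n A n) : Q2n A n :=
  MkQ2n (Gamma_quadric v).

(* Main.v *)
Require Import Defs.
From mathcomp Require Import all_boot all_algebra.
From Stdlib Require Import Relation_Operators.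
From mathcomp Require Import boolp.

Import GRing.Theory.
Local Open Scope quotient_scope.

(** The substitution s -> 1 - s preserves s(s - 1) and is given by the same integer polynomial over
    every ring, so [Gamma] commutes with ring morphisms, in particular with evaluation of T at 0 and
    1. Hence [Gamma] over A[T] carries a homotopy from x to y to one from [Gamma x] to [Gamma y]
    ([Gamma_elem_homotopic]), and [Gamma] descends to the quotient. The identity [GammaK] descends
    with it, and an involution is its own inverse, hence bijective. *)

Lemma GammaK (A : comNzRingType) (n : nat) : involutive (@Gamma A n).
Proof.
move=> v; apply: val_inj; case: v => [[[s f] g] e] /=.
by rewrite opprB addrC subrK.
Qed.

Lemma Gamma_Q2n_map (A B : comNzRingType) (n : nat) (phi : {rmorphism A -> B})
    (v : Q2n A n) : Q2n_map phi (Gamma v) = Gamma (Q2n_map phi v).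
Proof.
apply: val_inj; case: v => [[[s f] g] e] /=.
by rewrite rmorphB rmorph1.
Qed.

Lemma Gamma_elem_homotopic {A : comNzRingType} {n : nat} (x y : Q2n A n) :
  elem_homotopic x y -> elem_homotopic (Gamma x) (Gamma y).
Proof.
by case=> H [<- <-]; exists (Gamma H); rewrite /Q2n_eval !Gamma_Q2n_map.
Qed.

Lemma Gamma_homotopic {A : comNzRingType} {n : nat} (x y : Q2n A n) :
  homotopic x y -> homotopic (Gamma x) (Gamma y).
Proof.
move=> /asboolP hxy; apply/asboolP; elim: hxy => {x y}.
- by move=> x y /Gamma_elem_homotopic; apply: rst_step.
- by move=> x; apply: rst_refl.
- by move=> x y _; apply: rst_sym.
- by move=> x y z _ hxy _; apply: rst_trans hxy.
Qed.

(** Computed on a chosen representative; independence of that choice is [pi0_Gamma_class]. *)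
Definition pi0_Gamma {A : comNzRingType} {n : nat} (c : pi0_Q2n A n) :
    pi0_Q2n A n :=
  pi0_class (Gamma (repr (c : {eq_quot (@homotopic A n)}))).

Lemma pi0_Gamma_class (A : comNzRingType) (n : nat) (v : Q2n A n) :
  pi0_Gamma (pi0_class v) = pi0_class (Gamma v).
Proof.
(* It suffices that the chosen representative of the class of [v] is homotopic to [v]. *)
by apply/eqmodP/Gamma_homotopic/eqmodP; rewrite reprK.
Qed.

Lemma pi0_GammaK (A : comNzRingType) (n : nat) : involutive (@pi0_Gamma A n).
Proof.
(* Unfolding only the inner application exposes a class, on which the outer one computes. *)
move=> c; rewrite {2}/pi0_Gamma pi0_Gamma_class GammaK.
exact: (reprK (c : {eq_quot (@homotopic A n)})).
Qed.

Theorem corollary5p4 (A : comNzRingType) (n : nat) (hn : 2 <= n) :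
  involutive (@Gamma A n) /\
  exists Gt : pi0_Q2n A n -> pi0_Q2n A n,
    [/\ forall v : Q2n A n, Gt (pi0_class v) = pi0_class (Gamma v),
        bijective Gt
      & involutive Gt].
Proof.
split; first exact: GammaK.
exists (@pi0_Gamma A n); split; last exact: pi0_GammaK.
- exact: pi0_Gamma_class.
- exact: inv_bij (@pi0_GammaK A n).
Qed.
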